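(* Let $J:\mathbb{R}^{Nn_u}\times\mathbb{R}^{Nn_u\times(N+1)n_x}\to\mathbb{R}$ be the objective function $J(u_{\mathrm{ff}},\Theta)$ defined in the context. Partition $\Theta\in\mathbb{R}^{Nn_u\times(N+1)n_x}$ into blocks $\theta_{i,j}\in\mathbb{R}^{n_u\times n_x}$, $0\le i\le N-1$, $0\le j\le N$. Then the problem of minimizing $J(u_{\mathrm{ff}},\Theta)$ over all $(u_{\mathrm{ff}},\Theta)\in\mathbb{R}^{Nn_u}\times\mathbb{R}^{Nn_u\times(N+1)n_x}$ subject to the causality constraints $\theta_{i,j}=0$ for all $0\le i\le N-1$, $0\le j\le N$ with $j>i$, admits a global minimizing pair $(u_{\mathrm{ff}},\Theta)$.
   Context: Setting. $N\ge 1$ is an integer (time horizon), $n_x,n_u,n_w\ge 1$, and for $k=0,\dots,N-1$ the matrices $A_k\in\mathbb{R}^{n_x\times n_x}$, $B_k\in\mathbb{R}^{n_x\times n_u}$, $G_k\in\mathbb{R}^{n_x\times n_w}$ are given, with each $G_k$ of full row rank. Also given are $\mu_0,\mu_d\in\mathbb{R}^{n_x}$, symmetric positive definite $S_0,S_d\in\mathbb{R}^{n_x\times n_x}$ and $S_w\in\mathbb{R}^{n_w\times n_w}$, and a real $\lambda>0$. (These come from the system $x_{k+1}=A_kx_k+B_ku_k+G_kw_k$ with $x_0\sim\mathcal N(\mu_0,S_0)$, i.i.d. $w_k\sim\mathcal N(0,S_w)$ independent of $x_0$, and goal terminal distribution $\mathcal N(\mu_d,S_d)$.) Let $\Phi(n,n)=I$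 and $\Phi(k,n)=A_{k-1}\cdots A_n$ for $k>n$. Define $\Gamma=[\,I_{n_x}\;\;\Phi(1,0)^{\mathrm T}\;\cdots\;\Phi(N,0)^{\mathrm T}]^{\mathrm T}\in\mathbb{R}^{(N+1)n_x\times n_x}$; $H_u\in\mathbb{R}^{(N+1)n_x\times Nn_u}$ the block matrix whose block in block-row $i\in\{0,\dots,N\}$ and block-column $j\in\{0,\dots,N-1\}$ is $\Phi(i,j+1)B_j$ if $i>j$ and $0$ otherwise; $H_w\in\mathbb{R}^{(N+1)n_x\times Nn_w}$ defined likewise with $G_j$ in place of $B_j$; $F=[0,\dots,0,I_{n_x}]\in\mathbb{R}^{n_x\times(N+1)n_x}$; $\tilde S=\Gamma S_0\Gamma^{\mathrm T}+H_w\,\mathrm{blkdiag}(S_w,\dots,S_w)\,H_w^{\mathrm T}$ (with $N$ copies of $S_w$). For $\Theta\in\mathbb{R}^{Nn_u\times(N+1)n_x}$ put $\Omega=F(I+H_u\Theta)$. The objective is $$J(u_{\mathrm{ff}},\Theta)=\mathrm{trace}(\Theta\tilde S\Theta^{\mathrm T})+\|u_{\mathrm{ff}}\|_2^2+\lambda\,W_2^2(u_{\mathrm{ff}},\Theta),$$ $$W_2^2(u_{\mathrm{ff}},\Theta)=\|\mu_d-F(\Gamma\mu_0+H_uu_{\mathrm{ff}})\|_2^2+\mathrm{trace}\big(\Omega\tilde S\Omega^{\mathrm T}+S_d\big)-2\,\mathrm{trace}\Big(\big(S_d^{1/2}\,\Omega\tilde S\Omega^{\mathrm T}\,S_d^{1/2}\big)^{1/2}\Big),$$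 where $(\cdot)^{1/2}$ is the symmetric positive semidefinite square root. ($W_2^2$ is the squared 2-Wasserstein distance between the terminal state distribution and $\mathcal N(\mu_d,S_d)$.) *)

(* Defs.v *)
From mathcomp Require Import all_boot all_order all_algebra.
From mathcomp Require Import classical_sets reals.

Set Implicit Arguments.
Unset Strict Implicit.
Unset Printing Implicit Defensive.

Import Order.TTheory GRing.Theory Num.Theory.
Local Open Scope ring_scope.

Definition posdefmx (R : realType) n (A : 'M[R]_n) : Prop :=
  A^T = A /\ forall x : 'cV[R]_n, x != 0 -> 0 < (x^T *m A *m x) 0 0.

Definition possemidefmx (R : realType) n (A : 'M[R]_n) : Prop :=
  A^T = A /\ forall x : 'cV[R]_n, 0 <= (x^T *m A *m x) 0 0.

(* A positive semidefinite A has exactly one positive semidefinite square root,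
   so the choice made by xget is forced; the default 0 is returned only when A
   has no such root, i.e. when A is not positive semidefinite. *)
Definition sqrtmx (R : realType) n (A : 'M[R]_n) : 'M[R]_n :=
  xget 0 [set B : 'M[R]_n | possemidefmx B /\ B *m B = A]%classic.

Definition sqnorm2 (R : realType) n (v : 'cV[R]_n) : R :=
  \sum_(i < n) v i 0 ^+ 2.

Lemma filter_rev_enumS N (k : 'I_N) n : (n <= k)%N ->
  [seq l : 'I_N <- rev (enum 'I_N) | (n <= l < k.+1)%N]
    = k :: [seq l : 'I_N <- rev (enum 'I_N) | (n <= l < k)%N].
Proof.
move=> le_nk; set gtI := fun i j : 'I_N => (j < i)%N.
have gt_trans : transitive gtI by move=> y x z xy yz; apply: ltn_trans yz xy.
have gt_sorted : sorted gtI (rev (enum 'I_N)).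
  rewrite rev_sorted; have := iota_ltn_sorted 0 N.
  by rewrite -val_enum_ord sorted_map.
apply: (@sorted_eq _ gtI) => //.
- by move=> x y; rewrite /gtI; case: ltngtP.
- exact: sorted_filter.
- rewrite /= path_min_sorted; first exact: sorted_filter.
  by apply/allP => x; rewrite mem_filter => /andP[/andP[]].
apply: uniq_perm.
- by rewrite filter_uniq // rev_uniq enum_uniq.
- by rewrite /= mem_filter ltnn andbF filter_uniq // rev_uniq enum_uniq.
move=> l; rewrite inE !mem_filter !mem_rev !mem_enum !andbT ltnS.
rewrite [(l <= k)%N]leq_eqVlt -val_eqE /=; case: eqP => [->|_] //=.
by rewrite le_nk.
Qed.

(* Phi A k n = A_(k-1) *m ... *m A_n; the reversed enumeration puts the largest
   index leftmost. *)
Definition Phi (R : realType) N nx (A : 'I_N -> 'M[R]_nx) (k n : nat)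
    : 'M[R]_nx :=
  \prod_(l <- rev (enum 'I_N) | (n <= l < k)%N) A l.

Lemma Phi_diag (R : realType) N nx (A : 'I_N -> 'M[R]_nx) n :
  Phi A n n = 1%:M.
Proof. by rewrite /Phi big1 // => l; case: ltngtP. Qed.

Lemma PhiS (R : realType) N nx (A : 'I_N -> 'M[R]_nx) n (k : 'I_N) :
  (n <= k)%N -> Phi A k.+1 n = A k *m Phi A k n.
Proof.
move=> le_nk; rewrite /Phi -big_filter filter_rev_enumS // big_cons.
by rewrite big_filter.
Qed.

(* The block-structured dimensions (N+1)n_x, N n_u and N n_w are written as
   \sum_(i < N.+1) nx, \sum_(i < N) nu and \sum_(i < N) nw, the dimensions of
   the library's block matrices, so that blocks are given by submxblock. *)
Definition Gamma (R : realType) N nx (A : 'I_N -> 'M[R]_nx)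
    : 'M[R]_(\sum_(i < N.+1) nx, nx) :=
  \mxcol_(i < N.+1) Phi A i 0.

(* H_u when fed B, H_w when fed G. *)
Definition inputmx (R : realType) N nx m
    (A : 'I_N -> 'M[R]_nx) (B : 'I_N -> 'M[R]_(nx, m))
    : 'M[R]_(\sum_(i < N.+1) nx, \sum_(j < N) m) :=
  \mxblock_(i < N.+1, j < N)
    (if (j < i)%N then Phi A i j.+1 *m B j else 0).

Definition Flast (R : realType) N nx : 'M[R]_(nx, \sum_(i < N.+1) nx) :=
  \mxrow_(i < N.+1) (if i == ord_max then 1%:M else 0 : 'M[R]_nx).

Definition Stilde (R : realType) N nx nw
    (A : 'I_N -> 'M[R]_nx) (G : 'I_N -> 'M[R]_(nx, nw))
    (S0 : 'M[R]_nx) (Sw : 'M[R]_nw) : 'M[R]_(\sum_(i < N.+1) nx) :=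
  Gamma A *m S0 *m (Gamma A)^T
  + inputmx A G *m (\mxdiag_(i < N) Sw) *m (inputmx A G)^T.

Definition Omega (R : realType) N nx nu
    (A : 'I_N -> 'M[R]_nx) (B : 'I_N -> 'M[R]_(nx, nu))
    (Theta : 'M[R]_(\sum_(i < N) nu, \sum_(j < N.+1) nx))
    : 'M[R]_(nx, \sum_(j < N.+1) nx) :=
  Flast R N nx *m (1%:M + inputmx A B *m Theta).

Definition W2sq (R : realType) N nx nu nw
    (A : 'I_N -> 'M[R]_nx) (B : 'I_N -> 'M[R]_(nx, nu))
    (G : 'I_N -> 'M[R]_(nx, nw)) (mu0 mud : 'cV[R]_nx)
    (S0 Sd : 'M[R]_nx) (Sw : 'M[R]_nw)
    (uff : 'cV[R]_(\sum_(i < N) nu))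
    (Theta : 'M[R]_(\sum_(i < N) nu, \sum_(j < N.+1) nx)) : R :=
  let Sf := Omega A B Theta *m Stilde A G S0 Sw *m (Omega A B Theta)^T in
  sqnorm2 (mud - Flast R N nx *m (Gamma A *m mu0 + inputmx A B *m uff))
  + \tr (Sf + Sd)
  - 2 * \tr (sqrtmx (sqrtmx Sd *m Sf *m sqrtmx Sd)).

Definition J (R : realType) N nx nu nw
    (A : 'I_N -> 'M[R]_nx) (B : 'I_N -> 'M[R]_(nx, nu))
    (G : 'I_N -> 'M[R]_(nx, nw)) (mu0 mud : 'cV[R]_nx)
    (S0 Sd : 'M[R]_nx) (Sw : 'M[R]_nw) (lambda : R)
    (uff : 'cV[R]_(\sum_(i < N) nu))
    (Theta : 'M[R]_(\sum_(i < N) nu, \sum_(j < N.+1) nx)) : R :=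
  \tr (Theta *m Stilde A G S0 Sw *m Theta^T) + sqnorm2 uff
  + lambda * W2sq A B G mu0 mud S0 Sd Sw uff Theta.

Definition causal (R : realType) N nx nu
    (Theta : 'M[R]_(\sum_(i < N) nu, \sum_(j < N.+1) nx)) : Prop :=
  forall (i : 'I_N) (j : 'I_N.+1), (i < j)%N -> submxblock Theta i j = 0.

(* Main.v *)
Require Import Defs.
From HB Require Import structures.
From mathcomp Require Import all_boot all_order all_algebra.
From mathcomp Require Import all_classical all_reals all_analysis.
Import numFieldNormedType.Exports.
From mathcomp Require Import finmap complex ring lra.

Set Implicit Arguments.
Unset Strict Implicit.
Unset Printing Implicit Defensive.

Import Order.TTheory GRing.Theory Num.Theory.
Local Open Scope ring_scope.

(** The objective splits as a function of u_ff alone plus a function of Theta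
alone.  Both summands are nonnegative, coercive and lower semicontinuous in
suitable coordinates, and such a function attains its minimum on a linear
subspace ([lsc_coercive_min_rowspace]).

For the feedback part, put L = S~^(1/2) and Y = Theta L.  Then
trace(Theta S~ Theta^T) is the squared Frobenius norm of Y, and
Omega L = F L + F H_u Y, so that the feedback cost depends on Theta through Y
only.  As Theta ranges over the causal gains, Y ranges over a linear subspace
([causal_image_rowspace]), which is closed.  Once Y minimizes the cost on this
subspace, any causal Theta with Theta L = Y is a minimizer.

What remains is the term - 2 trace((Q Sf Q)^(1/2)), with Q = S_d^(1/2).
For P positive semidefinite and Z positive definite,
  trace(Z^-1 P^2) + trace Z - 2 trace P = trace((P - Z) Z^-1 (P - Z)) >= 0,
and Z = P + d I makes the left side as small as desired ([mxtrace_sqrt_le] and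
[mxtrace_sqrt_approx]).  Hence - 2 trace(C^(1/2)) is the supremum over Z of the
functions - trace(Z^-1 C) - trace Z, which are affine in C, and it is lower
semicontinuous ([bures_lsc]).  The same inequality at Z = S_d shows that
the covariance part of the Wasserstein distance is nonnegative ([bures_ge0]),
so that the squared norm of Y is a lower bound of the cost: this is
coercivity.

Square roots of positive semidefinite matrices are obtained as polynomials in
the matrix ([possemidef_sqrt_exists]): a real symmetric matrix is annihilated
by a product of distinct factors X - r over real eigenvalues r, by the spectral
theorem over the complex numbers, and a polynomial q with q(r)^4 = r at these
points gives the root q(A)^2. *)

(** * Square roots of positive semidefinite matrices *)

Lemma polynomial_interpolation (F : fieldType) (f : F -> F) (rs : seq F) :
  uniq rs -> exists q : {poly F}, {in rs, forall r, q.[r] = f r}.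
Proof.
elim: rs => [_|r rs IHrs /= /andP[r_rs /IHrs[q qf]]]; first by exists 0.
pose p := \prod_(z <- rs) ('X - z%:P).
have pr : p.[r] != 0.
  by rewrite -[p.[r] == 0]/(root p r) root_prod_XsubC.
exists (q + ((f r - q.[r]) / p.[r]) *: p) => z.
rewrite in_cons hornerD hornerZ => /predU1P[->|z_rs].
  by rewrite divfK // addrC subrK.
have /rootP -> : root p z by rewrite root_prod_XsubC.
by rewrite mulr0 addr0 qf.
Qed.

(** The complexification of A is unitarily diagonalizable with a real diagonal,
and the product of the factors X - r over the distinct diagonal entries r
vanishes at this diagonal matrix.  The embedding into a closed field keeps of
the complex numbers only that their real elements are the image of R. *)
Lemma symmetric_annihilator_embedded (R : realType) (C : numClosedFieldType)
    (toC : {rmorphism R -> C}) (re : C -> R)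
    (toC_real : forall r, toC r \is Num.real)
    (toCK : forall c, c \is Num.real -> toC (re c) = c)
    n (A : 'M[R]_n.+1) : A^T = A ->
  exists rs : seq R, [/\ uniq rs, {in rs, forall r, eigenvalue A r} &
    horner_mx A (\prod_(r <- rs) ('X - r%:P)) = 0].
Proof.
move=> symA; pose AC := map_mx toC A.
have realAC : AC \is a realmx by apply/mxOverP => i j; rewrite mxE.
have hermAC : AC \is hermsymmx.
  apply: realsym_hermsym realAC.
  by apply/is_hermitianmxP; rewrite expr0 scale1r map_mx_id // map_trmx symA.
set P := spectralmx AC; set d := spectral_diag AC.
have unitP : P \in unitmx := spectral_unit AC.
have defAC : AC = invmx P *m diag_mx d *m P.
  exact/orthomx_spectralP/hermitian_normalmx.
have hornerAC p : horner_mx AC p = invmx P *m diag_mx (map_mx (horner p) d) *m P.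
  by rewrite defAC horner_mx_uconjC // horner_mx_diag.
pose r i := re (d 0 i).
have rE i : d 0 i = toC (r i).
  by rewrite toCK //; exact: (mxOverP (hermitian_spectral_diag_real hermAC)).
exists (undup [seq r i | i : 'I_n.+1]); split; first exact: undup_uniq.
  move=> _ /[!mem_undup] /mapP[i _ ->].
  (* Being an eigenvalue is a property of the characteristic polynomial, so it
     descends from the closed field to R. *)
  rewrite eigenvalue_root_char -(fmorph_root toC) map_char_poly -rE.
  rewrite -eigenvalue_root_char; apply/eigenvalueP; exists (row i P).
    rewrite -/AC -row_mul defAC !mulmxA mulmxV // mul1mx.
    by rewrite row_mul row_diag_mx -scalemxAl -rowE.
  rewrite rowE mulmx_free_eq0 ?row_free_unit //.
  by apply/eqP => /rowP/(_ i); rewrite !mxE !eqxx => /eqP; rewrite oner_eq0.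
apply/(map_mx_inj (f := toC)); rewrite map_horner_mx map_mx0 hornerAC.
rewrite map_prod_XsubC (_ : map_mx _ _ = 0) ?linear0 ?mulmx0 ?mul0mx //.
apply/rowP => i; rewrite !mxE rE; apply/rootP.
rewrite -(big_map toC xpredT (fun c => 'X - c%:P)) root_prod_XsubC.
by rewrite map_f // mem_undup map_f ?mem_enum.
Qed.

Section Spectral.
Variable R : realType.

Lemma symmetric_annihilator n (A : 'M[R]_n.+1) : A^T = A ->
  exists rs : seq R, [/\ uniq rs, {in rs, forall r, eigenvalue A r} &
    horner_mx A (\prod_(r <- rs) ('X - r%:P)) = 0].
Proof.
apply: (@symmetric_annihilator_embedded R R[i]%C (real_complex R) (@complex.Re R)) => [r|c].
  by apply/complex_realP; exists r.
exact: RRe_real.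
Qed.

Lemma possemidef_eigenvalue_ge0 n (A : 'M[R]_n) r :
  possemidefmx A -> eigenvalue A r -> 0 <= r.
Proof.
case=> _ A_ge0 /eigenvalueP[v vA /rV0Pn[i vi]].
have := A_ge0 v^T; rewrite trmxK vA -scalemxAl mxE.
rewrite pmulr_lge0 // mxE (bigD1 i) //= mxE ltr_pwDl //.
  by rewrite -expr2 lt_def sqr_ge0 sqrf_eq0 vi.
by apply: sumr_ge0 => j _; rewrite mxE -expr2 sqr_ge0.
Qed.

Lemma tr_horner_mx n (A : 'M[R]_n.+1) (p : {poly R}) :
  A^T = A -> (horner_mx A p)^T = horner_mx A p.
Proof.
move=> symA; elim/poly_ind: p => [|p c IHp]; first by rewrite rmorph0 trmx0.
rewrite rmorphD rmorphM /= horner_mx_X horner_mx_C linearD /= tr_scalar_mx.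
congr (_ + _); rewrite trmx_mul symA IHp.
exact: comm_mx_horner (comm_mx_refl A).
Qed.

Lemma possemidef_gram m n (M : 'M[R]_(m, n)) : possemidefmx (M *m M^T).
Proof.
split=> [|x]; first by rewrite trmx_mul trmxK.
rewrite mulmxA -mulmxA -[x^T *m M]trmxK trmx_mul trmxK mxE.
by apply: sumr_ge0 => i _; rewrite mxE -expr2 sqr_ge0.
Qed.

(** Interpolating the fourth root at the eigenvalues, rather than the square
root, makes the root a Gram matrix q(A) q(A)^T, hence positive semidefinite. *)
Lemma possemidef_sqrt_exists n (A : 'M[R]_n) :
  possemidefmx A -> exists P : 'M[R]_n, possemidefmx P /\ P *m P = A.
Proof.
case: n A => [|n] A psdA; first by exists A; split=> //; rewrite [LHS]flatmx0 [RHS]flatmx0.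
have symA := psdA.1.
have [rs [uniq_rs eig_rs A0]] := symmetric_annihilator symA.
have [q qE] := polynomial_interpolation (fun r => Num.sqrt (Num.sqrt r)) uniq_rs.
pose Q := horner_mx A q.
have trQ : Q^T = Q by exact: tr_horner_mx.
exists (Q *m Q); split; first by rewrite -{2}trQ; exact: possemidef_gram.
have /dvdpP[u /(congr1 (horner_mx A))] :
    \prod_(r <- rs) ('X - r%:P) %| (q * q) * (q * q) - 'X.
  apply: uniq_roots_dvdp; last by rewrite uniq_rootsE.
  apply/allP => r r_rs; have r_ge0 := possemidef_eigenvalue_ge0 psdA (eig_rs r r_rs).
  rewrite /root hornerD hornerN hornerX !hornerM qE // -!expr2.
  by rewrite !sqr_sqrtr ?sqrtr_ge0 // subrr.
rewrite rmorphB !rmorphM /= A0 mulr0 horner_mx_X => /eqP; rewrite subr_eq0.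
by move/eqP.
Qed.

Lemma sqrtmxP n (A : 'M[R]_n) : possemidefmx A ->
  possemidefmx (sqrtmx A) /\ sqrtmx A *m sqrtmx A = A.
Proof. by move/possemidef_sqrt_exists/(xgetPex 0). Qed.

End Spectral.

(** * The trace of a square root as an infimum *)

Section Variational.
Variable R : realType.

Lemma possemidef_congr m n (M : 'M[R]_(m, n)) (A : 'M[R]_n) :
  possemidefmx A -> possemidefmx (M *m A *m M^T).
Proof.
case=> symA A_ge0; split=> [|x]; first by rewrite !trmx_mul trmxK symA mulmxA.
by have := A_ge0 (M^T *m x); rewrite trmx_mul trmxK !mulmxA.
Qed.

Lemma mxtrace_possemidef_ge0 n (A : 'M[R]_n) : possemidefmx A -> 0 <= \tr A.
Proof.
case=> _ A_ge0; apply: sumr_ge0 => i _.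
have := A_ge0 (delta_mx i 0).
by rewrite trmx_delta -mulmxA -colE -rowE !mxE.
Qed.

Lemma mxtrace_mul_possemidef_ge0 n (A B : 'M[R]_n) :
  possemidefmx A -> possemidefmx B -> 0 <= \tr (A *m B).
Proof.
move=> psdA /possemidef_sqrt_exists[P [psdP <-]].
rewrite mulmxA mxtrace_mulC mulmxA -{2}psdP.1.
exact/mxtrace_possemidef_ge0/possemidef_congr.
Qed.

Lemma posdef_unitmx n (Z : 'M[R]_n) : posdefmx Z -> Z \in unitmx.
Proof.
case=> symZ Z_gt0; rewrite -row_free_unit -kermx_eq0; apply/eqP/row_matrixP => i.
rewrite row0; apply/eqP; apply: contraT => xN0.
have := Z_gt0 (row i (kermx Z))^T; rewrite trmx_eq0 => /(_ xN0).
by rewrite trmxK -row_mul mulmx_ker row0 mul0mx mxE ltxx.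
Qed.

Lemma posdef_possemidef n (Z : 'M[R]_n) : posdefmx Z -> possemidefmx Z.
Proof.
case=> symZ Z_gt0; split=> // x; have [->|/Z_gt0/ltW//] := eqVneq x 0.
by rewrite mulmx0 mxE.
Qed.

Lemma possemidef_invmx n (Z : 'M[R]_n) : posdefmx Z -> possemidefmx (invmx Z).
Proof.
move=> pdZ; have uZ := posdef_unitmx pdZ.
have symV : (invmx Z)^T = invmx Z by rewrite trmx_inv pdZ.1.
rewrite (_ : invmx Z = invmx Z *m Z *m (invmx Z)^T).
  exact/possemidef_congr/posdef_possemidef.
by rewrite symV mulVmx // mul1mx.
Qed.

(** The difference of the two sides is the trace of (P - Z) Z^-1 (P - Z). *)
Lemma mxtrace_sqrt_le n (P Z : 'M[R]_n) : possemidefmx P -> posdefmx Z ->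
  2 * \tr P <= \tr (invmx Z *m (P *m P)) + \tr Z.
Proof.
move=> psdP pdZ; have uZ := posdef_unitmx pdZ.
have := mxtrace_possemidef_ge0 (possemidef_congr (P - Z) (possemidef_invmx pdZ)).
rewrite linearB /= psdP.1 pdZ.1 mulmxBl mulmxV // mulmxBr !mulmxBl mulmxKV //.
rewrite !mul1mx !linearB /= [\tr (_ *m P)]mxtrace_mulC mulmxA.
rewrite [\tr (P *m P *m _)]mxtrace_mulC; lra.
Qed.

Lemma posdef_addscalar n (P : 'M[R]_n) e :
  possemidefmx P -> 0 < e -> posdefmx (P + e%:M).
Proof.
case=> symP P_ge0 e_gt0; split=> [|x /cV0Pn[i xi]].
  by rewrite linearD /= tr_scalar_mx symP.
rewrite mulmxDr mulmxDl mxE ltr_wpDl // mul_mx_scalar -scalemxAl mxE.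
rewrite mulr_gt0 // mxE (bigD1 i) //= mxE ltr_pwDl //.
  by rewrite -expr2 lt_def sqr_ge0 sqrf_eq0 xi.
by apply: sumr_ge0 => j _; rewrite mxE -expr2 sqr_ge0.
Qed.

(** Near-optimality of Z = P + e I in [mxtrace_sqrt_le].  Since
Z^-1 P^2 = P - e Z^-1 P, the gap is e n - e trace(Z^-1 P), and the trace of a
product of positive semidefinite matrices is nonnegative. *)
Lemma mxtrace_sqrt_approx n (P : 'M[R]_n) e : possemidefmx P -> 0 < e ->
  \tr (invmx (P + e%:M) *m (P *m P)) + \tr (P + e%:M) <= 2 * \tr P + e * n%:R.
Proof.
move=> psdP e_gt0; have pdZ := posdef_addscalar psdP e_gt0.
set Z := P + e%:M in pdZ *; have uZ := posdef_unitmx pdZ.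
have -> : invmx Z *m (P *m P) = P - e *: (invmx Z *m P).
  have {1}-> : P = Z - e%:M by rewrite addrK.
  by rewrite mulmxBl mulmxBr mulKmx // mul_scalar_mx -scalemxAr.
rewrite linearB linearZ linearD /= mxtrace_scalar -[_ *+ n]mulr_natr.
have := mxtrace_mul_possemidef_ge0 (possemidef_invmx pdZ) psdP.
move=> /(mulr_ge0 (ltW e_gt0)); lra.
Qed.

End Variational.

(** * Minimizing coercive lower semicontinuous functions *)

Section Minimization.
Variable R : realType.
Local Open Scope classical_set_scope.

(** If f had no minimizer on K, the open sets where f exceeds one of its values
f y would cover K.  Among the finitely many y of a subcover, the one with the
least f y would lie in none of the sets. *)
Lemma lsc_compact_min (T : ptopologicalType) (f : T -> R) (K : set T) :
  K !=set0 -> compact K -> (forall a, open [set x | a < f x]) ->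
  exists2 x, K x & forall y, K y -> f x <= f y.
Proof.
move=> [x0 Kx0]; rewrite compact_cover => cK lsc; apply: contrapT => nomin.
have [D DK cover_D] : finite_subset_cover K (fun y => [set x | f y < f x]) K.
  apply: cK => [y _|x Kx]; first exact: lsc.
  apply: contrapT => nox; apply: nomin; exists x => // y Ky.
  by rewrite leNgt; apply/negP => fyx; apply: nox; exists y.
have [y Dy ymin] : exists2 y, y \in D & forall z, z \in D -> f y <= f z.
  have [z0 /= Dz0 _] := cover_D _ Kx0.
  pose i := [arg min_(i < ([` Dz0])%fset) f (val i)]%O.
  exists (val i) => [|z Dz]; first exact: valP.
  rewrite /i; case: arg_minP => // j _ /(_ ([` Dz])%fset isT); exact.
have /cover_D[z /= Dz] : K y by exact/set_mem/DK.
by rewrite ltNge ymin.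
Qed.

(** Continuity of matrix-valued maps is handled entry by entry, which reduces
polynomial expressions in matrices to sums and products of real functions. *)
Definition entrywise_continuous (T : topologicalType) m n
    (F : T -> 'M[R]_(m, n)) := forall i j, continuous (fun x => F x i j).

Section Continuity.
Variable T : topologicalType.

Lemma continuous_addr (f g : T -> R) :
  continuous f -> continuous g -> continuous (fun x => f x + g x).
Proof. by move=> cf cg x; apply: continuousD; [exact: cf|exact: cg]. Qed.

Lemma continuous_oppr (f : T -> R) :
  continuous f -> continuous (fun x => - f x).
Proof. by move=> cf x; apply: continuousN; exact: cf. Qed.

Lemma continuous_mulr (f g : T -> R) :
  continuous f -> continuous g -> continuous (fun x => f x * g x).
Proof. by move=> cf cg x; apply: continuousM; [exact: cf|exact: cg]. Qed.

Lemma continuous_sumr (I : Type) (r : seq I) (F : I -> T -> R) :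
  (forall i, continuous (F i)) -> continuous (fun x => \sum_(i <- r) F i x).
Proof. by move=> cF; apply: continuous_big => //; exact: add_continuous. Qed.

Lemma entrywise_continuous_cst m n (M : 'M[R]_(m, n)) :
  entrywise_continuous (fun _ : T => M).
Proof. by move=> i j; exact: cst_continuous. Qed.

Lemma entrywise_continuousD m n (F G : T -> 'M[R]_(m, n)) :
  entrywise_continuous F -> entrywise_continuous G ->
  entrywise_continuous (fun x => F x + G x).
Proof.
move=> cF cG i j; under eq_fun do rewrite mxE.
by apply: continuous_addr; [exact: cF|exact: cG].
Qed.

Lemma entrywise_continuousM m n p (F : T -> 'M[R]_(m, n)) (G : T -> 'M[R]_(n, p)) :
  entrywise_continuous F -> entrywise_continuous G ->
  entrywise_continuous (fun x => F x *m G x).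
Proof.
move=> cF cG i j; under eq_fun do rewrite mxE.
apply: continuous_sumr => k.
by apply: continuous_mulr; [exact: cF|exact: cG].
Qed.

Lemma entrywise_continuous_trmx m n (F : T -> 'M[R]_(m, n)) :
  entrywise_continuous F -> entrywise_continuous (fun x => (F x)^T).
Proof. by move=> cF i j; under eq_fun do rewrite mxE; exact: cF. Qed.

Lemma continuous_mxtrace n (F : T -> 'M[R]_n) :
  entrywise_continuous F -> continuous (fun x => \tr (F x)).
Proof. by move=> cF; apply: continuous_sumr => i; exact: cF. Qed.

End Continuity.

Lemma entrywise_continuous_vec_mx m n :
  entrywise_continuous (@vec_mx R m n).
Proof. by move=> i j; under eq_fun do rewrite mxE; exact: coord_continuous. Qed.

(** The row space of K is the zero set of the linear forms given by the columns
of its cokernel. *)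
Lemma closed_rowspace m n (K : 'M[R]_(m, n)) :
  closed [set x : 'rV[R]_n | (x <= K)%MS].
Proof.
rewrite (_ : mkset _ = \bigcap_(j in setT) [set x : 'rV[R]_n | (x *m cokermx K) 0 j = 0]).
  apply: closed_bigI => j _.
  apply: (@closed_comp _ _ (fun x : 'rV[R]_n => (x *m cokermx K) 0 j) [set y | y = 0]).
    move=> x _; apply: entrywise_continuousM (@entrywise_continuous_cst _ _ _ _) _ _ _.
    by move=> i k; exact: coord_continuous.
  exact: closed_eq.
apply/seteqP; split=> [x /=|x xK /=]; rewrite submxE.
  by move=> /eqP xK j _ /=; rewrite xK mxE.
by apply/eqP/rowP => j; rewrite [RHS]mxE; exact: xK.
Qed.

(** Outside a large box f exceeds f 0, and the row space of K meets the box in a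
compact set containing 0. *)
Lemma lsc_coercive_min_rowspace m n (K : 'M[R]_(m, n)) (f : 'rV[R]_n -> R) :
  (forall (x : 'rV[R]_n) i, x 0 i ^+ 2 <= f x) -> (forall a, open [set x | a < f x]) ->
  exists x, (x <= K)%MS /\ forall y, (y <= K)%MS -> f x <= f y.
Proof.
move=> coer lsc; pose M := 1 + Num.max 0 (f 0).
have M0 : 0 <= M by rewrite addr_ge0 // le_max lexx.
(* With s = max 0 (f 0), f 0 <= s < (1 + s) ^ 2. *)
have fM : f 0 < M ^+ 2.
  have : f 0 <= Num.max 0 (f 0) by rewrite le_max lexx orbT.
  have : 0 <= Num.max 0 (f 0) by rewrite le_max lexx.
  rewrite /M; set s := Num.max _ _; nra.
pose box := [set x : 'rV[R]_n | forall i, `[- M, M] (x ord0 i)].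
pose Kset := [set x : 'rV[R]_n | (x <= K)%MS].
have cpt : compact (box `&` Kset).
  apply: compact_closedI (@closed_rowspace _ _ K).
  by apply: (@rV_compact R n (fun=> `[- M, M])) => i; exact: segment_compact.
have K0 : (box `&` Kset) 0.
  split=> [i|]; last exact: sub0mx.
  by rewrite /= mxE in_itv /= oppr_le0 M0.
have [x [_ xK] xmin] := lsc_compact_min (ex_intro _ _ K0) cpt lsc.
(* For y outside the box, compare with 0: f x <= f 0 < M ^ 2 <= f y. *)
exists x; split=> // y yK; have [ybox|] := pselect (box y); first exact: xmin.
move/existsNP => [i /= yi]; apply: le_trans (xmin _ K0) (le_trans (ltW fM) _).
apply: le_trans (coer y i); rewrite -[leRHS]real_normK ?num_real //.
rewrite ler_sqr ?nnegrE //; apply: ltW; rewrite ltNge; apply/negP => yM.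
by apply: yi; rewrite in_itv /= -ler_norml.
Qed.

Lemma lsc_continuous (T : topologicalType) (f : T -> R) :
  continuous f -> forall a, open [set x | a < f x].
Proof.
move=> cf a; rewrite -[mkset _]/(f @^-1` [set z | a < z]).
by apply: open_comp => [? _|]; [exact: cf|exact: open_gt].
Qed.

(** The hypothesis says that f is pointwise a supremum of continuous minorants g;
where such a g exceeds a, on an open set, so does f. *)
Lemma lsc_sup (T : topologicalType) (f : T -> R) :
  (forall x e, 0 < e -> exists g : T -> R,
    [/\ continuous g, forall y, g y <= f y & f x <= g x + e]) ->
  forall a, open [set x | a < f x].
Proof.
move=> supf a; rewrite openE => x /= ax.
have e_gt0 : 0 < (f x - a) / 2 by rewrite divr_gt0 // subr_gt0.
have [g [cg gf fg]] := supf x _ e_gt0.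
have og := lsc_continuous cg a.
apply: filterS (open_nbhs_nbhs (conj og _)) => [y /=|/=].
  by move=> /lt_le_trans; apply.
lra.
Qed.

End Minimization.

(** * The covariance part of the Wasserstein distance *)

Section Bures.
Variables (R : realType) (n : nat) (Sd : 'M[R]_n).
Hypothesis pdSd : posdefmx Sd.

(** The squared Bures distance between S and Sd, which is the squared
2-Wasserstein distance between centered Gaussians with these covariances. *)
Definition bures (S : 'M[R]_n) : R :=
  \tr (S + Sd) - 2 * \tr (sqrtmx (sqrtmx Sd *m S *m sqrtmx Sd)).

Let sqrtSd := sqrtmxP (posdef_possemidef pdSd).

Lemma possemidef_sandwich S :
  possemidefmx S -> possemidefmx (sqrtmx Sd *m S *m sqrtmx Sd).
Proof. by move=> psdS; rewrite -{2}sqrtSd.1.1; exact: possemidef_congr. Qed.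

(** Apply [mxtrace_sqrt_le] with Z = Sd: then trace(Z^-1 Q S Q) = trace S, as
Q Sd^-1 Q = 1 for Q the root of Sd. *)
Lemma bures_ge0 S : possemidefmx S -> 0 <= bures S.
Proof.
move=> psdS; have [psdP defP] := sqrtmxP (possemidef_sandwich psdS).
have := mxtrace_sqrt_le psdP pdSd; rewrite defP.
have -> : \tr (invmx Sd *m (sqrtmx Sd *m S *m sqrtmx Sd)) = \tr S.
  have QVQ : sqrtmx Sd *m invmx Sd *m sqrtmx Sd = 1%:M.
    by apply: mulmx1C; rewrite mulmxA sqrtSd.2 mulmxV // posdef_unitmx.
  by rewrite mxtrace_mulC -!mulmxA mxtrace_mulC -mulmxA QVQ mulmx1.
by rewrite /bures linearD /=; lra.
Qed.

(** Lower semicontinuity in the form required by [lsc_sup]: the dual function at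
a Z fitted to the point x is a continuous minorant, tight at x up to e. *)
Lemma bures_lsc (T : topologicalType) (S : T -> 'M[R]_n) :
  entrywise_continuous S -> (forall x, possemidefmx (S x)) ->
  forall x e, 0 < e -> exists g : T -> R,
    [/\ continuous g, forall y, g y <= bures (S y) & bures (S x) <= g x + e].
Proof.
move=> cS psdS x e e_gt0; pose C y := sqrtmx Sd *m S y *m sqrtmx Sd.
have sqrtC y := sqrtmxP (possemidef_sandwich (psdS y)).
(* The shift d costs d * n <= e; dividing by n + 1 covers n = 0. *)
have d_gt0 : 0 < e / n.+1%:R by rewrite divr_gt0.
set d := e / n.+1%:R in d_gt0.
pose Z := sqrtmx (C x) + d%:M.
exists (fun y => \tr (S y + Sd) - (\tr (invmx Z *m C y) + \tr Z)); split.
- have cC : entrywise_continuous C.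
    by do 2?apply: entrywise_continuousM => //; exact: entrywise_continuous_cst.
  apply: continuous_addr.
    apply: continuous_mxtrace; apply: entrywise_continuousD => //.
    exact: entrywise_continuous_cst.
  apply: continuous_oppr; apply: continuous_addr; last exact: cst_continuous.
  apply: continuous_mxtrace; apply: entrywise_continuousM => //.
  exact: entrywise_continuous_cst.
- move=> y; rewrite lerD2l lerN2 -/(C y).
  have := mxtrace_sqrt_le (sqrtC y).1 (posdef_addscalar (sqrtC x).1 d_gt0).
  by rewrite (sqrtC y).2.
have := mxtrace_sqrt_approx (sqrtC x).1 d_gt0; rewrite (sqrtC x).2 -/(C x) -/Z.
have : d * n%:R <= e.
  by rewrite /d mulrAC ler_pdivrMr // ler_pM2l // ler_nat.
rewrite /bures -/(C x); lra.
Qed.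

End Bures.

(** * The covariance of the noisy trajectory *)

Section Covariance.
Variable R : realType.

Lemma possemidefD n (A B : 'M[R]_n) :
  possemidefmx A -> possemidefmx B -> possemidefmx (A + B).
Proof.
move=> [symA A_ge0] [symB B_ge0]; split=> [|x].
  by rewrite linearD /= symA symB.
by rewrite mulmxDr mulmxDl mxE addr_ge0.
Qed.

Lemma possemidef_mxdiag N n (S : 'M[R]_n) :
  possemidefmx S -> possemidefmx (\mxdiag_(i < N) S).
Proof.
case=> symS S_ge0; split=> [|x].
  by rewrite tr_mxdiag; under eq_mxdiag do rewrite symS.
rewrite -mulmxA -[x]submxcolK mul_mxdiag_mxcol tr_mxcol mul_mxrow_mxcol summxE.
by apply: sumr_ge0 => i _; rewrite mulmxA.
Qed.

Lemma possemidef_Stilde N nx nw (A : 'I_N -> 'M[R]_nx)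
    (G : 'I_N -> 'M[R]_(nx, nw)) (S0 : 'M[R]_nx) (Sw : 'M[R]_nw) :
  possemidefmx S0 -> possemidefmx Sw -> possemidefmx (Stilde A G S0 Sw).
Proof.
by move=> ? ?; apply: possemidefD; apply: possemidef_congr => //;
  exact: possemidef_mxdiag.
Qed.

End Covariance.

(** * The two decoupled minimization problems *)

Section Decoupled.
Variable R : realType.

Lemma sqr_entry_le_gram m n (Y : 'M[R]_(m, n)) i j :
  Y i j ^+ 2 <= \tr (Y *m Y^T).
Proof.
rewrite /mxtrace (bigD1 i) //= mxE (bigD1 j) //= mxE -expr2 -addrA lerDl.
rewrite addr_ge0 // sumr_ge0 // => k _; first by rewrite mxE -expr2 sqr_ge0.
by rewrite mxE sumr_ge0 // => l _; rewrite mxE -expr2 sqr_ge0.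
Qed.

Lemma sqr_coord_le_sqnorm2 n (v : 'cV[R]_n) i : v i 0 ^+ 2 <= sqnorm2 v.
Proof.
by rewrite /sqnorm2 (bigD1 i) //= lerDl sumr_ge0 // => k _; exact: sqr_ge0.
Qed.

Lemma sqnorm2_ge0 n (v : 'cV[R]_n) : 0 <= sqnorm2 v.
Proof. by apply: sumr_ge0 => i _; exact: sqr_ge0. Qed.

Lemma continuous_sqnorm2 (T : topologicalType) n (F : T -> 'cV[R]_n) :
  entrywise_continuous F -> continuous (fun x => sqnorm2 (F x)).
Proof.
move=> cF; apply: continuous_sumr => i.
by under eq_fun do rewrite expr2; apply: continuous_mulr; exact: cF.
Qed.

Lemma feedforward_min p q (b : 'cV[R]_q) (M : 'M[R]_(q, p)) lambda : 0 <= lambda ->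
  exists u : 'cV[R]_p, forall u',
    sqnorm2 u + lambda * sqnorm2 (b + M *m u)
      <= sqnorm2 u' + lambda * sqnorm2 (b + M *m u').
Proof.
move=> lambda_ge0.
pose f (x : 'rV[R]_p) := sqnorm2 x^T + lambda * sqnorm2 (b + M *m x^T).
have cx : entrywise_continuous (fun x : 'rV[R]_p => x^T).
  by apply: entrywise_continuous_trmx => i j; exact: coord_continuous.
have cf : continuous f.
  apply: continuous_addr; first exact: continuous_sqnorm2.
  apply: continuous_mulr; first exact: cst_continuous.
  apply: continuous_sqnorm2; apply: entrywise_continuousD.
    exact: entrywise_continuous_cst.
  by apply: entrywise_continuousM => //; exact: entrywise_continuous_cst.
have [x i|a|x [_ xmin]] := @lsc_coercive_min_rowspace R p p 1%:M f.
- have := sqr_coord_le_sqnorm2 x^T i; rewrite mxE => /le_trans; apply.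
  by rewrite lerDl mulr_ge0 // sqnorm2_ge0.
- exact: lsc_continuous.
by exists x^T => u'; have := xmin u'^T; rewrite submx1 /f !trmxK; apply.
Qed.

(** Y ranges over an arbitrary linear subspace, given as the row space of K in
vectorized form.  The cost dominates the squared norm of Y, because the second
term is nonnegative. *)
Lemma feedback_min m p q k (K : 'M[R]_(k, p * q)) (W0 : 'M[R]_(m, q))
    (M : 'M[R]_(m, p)) (Sd : 'M[R]_m) lambda :
  posdefmx Sd -> 0 < lambda ->
  let cost Y := \tr (Y *m Y^T)
    + lambda * bures Sd ((W0 + M *m Y) *m (W0 + M *m Y)^T) in
  exists Y : 'M[R]_(p, q), (mxvec Y <= K)%MS /\
    forall Y', (mxvec Y' <= K)%MS -> cost Y <= cost Y'.
Proof.
move=> pdSd lambda_gt0 cost.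
pose W (x : 'rV[R]_(p * q)) := W0 + M *m vec_mx x.
pose S x := W x *m (W x)^T.
have psdS x : possemidefmx (S x) by exact: possemidef_gram.
have cvec := @entrywise_continuous_vec_mx R p q.
have cW : entrywise_continuous W.
  apply: entrywise_continuousD; first exact: entrywise_continuous_cst.
  by apply: entrywise_continuousM => //; exact: entrywise_continuous_cst.
have cS : entrywise_continuous S.
  by apply: entrywise_continuousM => //; exact: entrywise_continuous_trmx.
have [x i|a|x [xK xmin]] := @lsc_coercive_min_rowspace R k (p * q) K (cost \o vec_mx).
- case/mxvec_indexP: i => i j; have := sqr_entry_le_gram (vec_mx x) i j.
  rewrite mxE => /le_trans; apply; rewrite lerDl mulr_ge0 //; first exact: ltW.
  exact: (bures_ge0 pdSd (psdS x)).
- apply: lsc_sup => x e e_gt0.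
  have [|g [cg gle leg]] := bures_lsc pdSd cS psdS x (e := e / lambda).
    by rewrite divr_gt0.
  exists (fun y => \tr (vec_mx y *m (vec_mx y)^T) + lambda * g y); split.
  + apply: continuous_addr.
      apply: continuous_mxtrace; apply: entrywise_continuousM => //.
      exact: entrywise_continuous_trmx.
    by apply: continuous_mulr; [exact: cst_continuous|exact: cg].
  + by move=> y; rewrite lerD2l ler_pM2l //; exact: gle.
  rewrite -addrA lerD2l -[e](divfK (lt0r_neq0 lambda_gt0)).
  by rewrite [_ / _ * _]mulrC -mulrDr ler_pM2l.
exists (vec_mx x); rewrite vec_mxK; split=> // Y' /xmin.
by rewrite /= mxvecK.
Qed.

End Decoupled.

(** * Causal gains *)

Section Causality.
Variables (R : realType) (N nx nu : nat).
Local Notation gain := ('M[R]_(\sum_(i < N) nu, \sum_(j < N.+1) nx)).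

(** The causal gains are the image of this linear projection, hence so are their
products with a fixed matrix the image of a linear map. *)
Definition causal_part (Theta : gain) : gain :=
  \mxblock_(i < N, j < N.+1) (if (i < j)%N then 0 else submxblock Theta i j).

Fact causal_part_is_linear : linear causal_part.
Proof.
move=> c Theta Theta'; apply/matrixP => i j; rewrite !mxE.
by case: ifP; rewrite !mxE ?mulr0 ?addr0.
Qed.
HB.instance Definition _ :=
  GRing.isLinear.Build R gain gain _ causal_part causal_part_is_linear.

Lemma causal_causal_part Theta : causal (causal_part Theta).
Proof. by move=> i j ij; rewrite mxblockK ij. Qed.

Lemma causal_part_id Theta : causal Theta -> causal_part Theta = Theta.
Proof.
move=> cT; rewrite -[RHS]submxblockK; apply/eq_mxblock => i j.
by case: ifP => // /cT.
Qed.

Lemma causal_image_rowspace q (L : 'M[R]_(\sum_(j < N.+1) nx, q)) :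
  exists K : 'M[R]_((\sum_(i < N) nu) * (\sum_(j < N.+1) nx),
                   (\sum_(i < N) nu) * q),
    forall Y, (mxvec Y <= K)%MS <-> exists2 Theta : gain, causal Theta & Y = Theta *m L.
Proof.
exists (lin_mx (mulmxr L \o causal_part)) => Y; split.
  move=> /submxP[v]; rewrite -[v]vec_mxK mul_vec_lin /= => /(can_inj mxvecK) ->.
  by exists (causal_part (vec_mx v)) => //; exact: causal_causal_part.
case=> Theta cT ->; apply/submxP; exists (mxvec Theta).
by rewrite mul_vec_lin /= causal_part_id.
Qed.

End Causality.

(** * Existence of a minimizing pair *)

Theorem proposition2 (R : realType) (N nx nu nw : nat)
    (hN : (0 < N)%N) (hnx : (0 < nx)%N) (hnu : (0 < nu)%N) (hnw : (0 < nw)%N)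
    (A : 'I_N -> 'M[R]_nx) (B : 'I_N -> 'M[R]_(nx, nu))
    (G : 'I_N -> 'M[R]_(nx, nw)) (hG : forall k : 'I_N, row_free (G k))
    (mu0 mud : 'cV[R]_nx) (S0 Sd : 'M[R]_nx) (Sw : 'M[R]_nw)
    (hS0 : posdefmx S0) (hSd : posdefmx Sd) (hSw : posdefmx Sw)
    (lambda : R) (hlambda : 0 < lambda) :
  exists (uff : 'cV[R]_(\sum_(i < N) nu))
         (Theta : 'M[R]_(\sum_(i < N) nu, \sum_(j < N.+1) nx)),
    causal Theta /\
    forall (uff' : 'cV[R]_(\sum_(i < N) nu))
           (Theta' : 'M[R]_(\sum_(i < N) nu, \sum_(j < N.+1) nx)),
      causal Theta' ->
      J A B G mu0 mud S0 Sd Sw lambda uff Theta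
        <= J A B G mu0 mud S0 Sd Sw lambda uff' Theta'.
Proof.
set S := Stilde A G S0 Sw; set F := Flast R N nx; set H := inputmx A B.
have psdS : possemidefmx S by apply: possemidef_Stilde; exact: posdef_possemidef.
have [[symL _] LL] := sqrtmxP psdS; set L := sqrtmx S in symL LL.
(* Up to the factor L, the terminal map is affine in Y = Theta L; the feedforward
   residual is written b + M u to match [feedforward_min]. *)
pose b := mud - F *m (Gamma A *m mu0).
pose cost_u u := sqnorm2 u + lambda * sqnorm2 (b + - (F *m H) *m u).
pose W Y := F *m L + F *m H *m Y.
pose cost_Y Y := \tr (Y *m Y^T) + lambda * bures Sd (W Y *m (W Y)^T).
have JE u Theta : J A B G mu0 mud S0 Sd Sw lambda u Theta
    = cost_u u + cost_Y (Theta *m L).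
  have -> : cost_Y (Theta *m L) = \tr (Theta *m S *m Theta^T)
      + lambda * bures Sd (Omega A B Theta *m S *m (Omega A B Theta)^T).
    have WE : W (Theta *m L) = Omega A B Theta *m L.
      by rewrite /W /Omega mulmxDr mulmx1 mulmxDl !mulmxA.
    by rewrite /cost_Y WE !trmx_mul symL -LL !mulmxA.
  have bE : b + - (F *m H) *m u = mud - F *m (Gamma A *m mu0 + H *m u).
    by rewrite /b mulNmx mulmxDr opprD addrA !mulmxA.
  rewrite /J /W2sq /cost_u bE -/S -/F -/H /bures; ring.
have [u umin] := feedforward_min b (- (F *m H)) (ltW hlambda).
have [K KP] := causal_image_rowspace nu L.
have [Y [YK Ymin]] := feedback_min K (F *m L) (F *m H) hSd hlambda.
case: ((KP Y).1 YK) => Theta cTheta defY.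
exists u, Theta; split=> [|u' Theta' cTheta']; first exact: cTheta.
rewrite !JE; apply: lerD; first exact: umin.
by rewrite -defY; apply/Ymin/KP; exists Theta'.
Qed.
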